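(* Let $\beta$ be a positive braid word on $q$ strands with crossings $b_1,\ldots,b_w$, let $Y\subseteq\{b_1,\ldots,b_w\}$ be a subset of its crossings, and let $B_\beta$ be the path matrix of $\beta$. Let $\varepsilon_Y\colon\mathscr{A}\to\mathbf{Z}_2$ be the evaluation homomorphism sending the elements of $Y$ to $1$ and all other generators of $\mathscr{A}$ to $0$, where $\mathscr{A}$ is the differential graded algebra of the Lagrangian diagram $\gamma_\beta$ of the Legendrian closure of $\beta$. Then $Y$ is an augmentation of $\gamma_\beta$ if and only if the matrix $\varepsilon_Y(B_\beta)$, obtained by applying $\varepsilon_Y$ to each entry, is such that every upper left corner square submatrix of it (of size $n\times n$, for $n=1,\ldots,q$) has determinant $1$ in $\mathbf{Z}_2$.
   Context: Positive braid words. A positive braid word on $q$ strands is a word $\beta=\sigma_{i_1}\sigma_{i_2}\cdots\sigma_{i_w}$ in the standard generators $\sigma_1,\ldots,\sigma_{q-1}$ of the braid group. It is drawn horizontally, read from left to right; the left and right endpoints of the strands are labeled $1,\ldots,q$ from top to bottom, $\sigma_i$ is a crossing between levels $i$ and $i+1$, and the crossings are labeled $b_1,\ldots,b_w$ from left to right. Path matrix. $B_\beta=[B_{i,j}]$ is the $q\times q$ matrix in which $B_{i,j}$ is the sum of the following products: for each path composed of parts of the strands of $\beta$ that connects the left endpoint $i$ to the right endpoint $j$ (travelling from left to right) so that it only turns around quadrants facing up (at a crossing, a path arriving on the upper incoming strand may turn and leave on the upper outgoing strand), take the product, from left to right, of the labels of the crossings at which it turns. Equivalently, $B_\beta=B_{\sigma_{i_1}}(b_1)B_{\sigma_{i_2}}(b_2)\cdots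 B_{\sigma_{i_w}}(b_w)$, where $B_{\sigma_i}(b)$ is the $q\times q$ identity matrix with the block in rows and columns $i,i+1$ replaced by $\begin{bmatrix} b&1\\1&0\end{bmatrix}$ (for the empty word, $B_\beta$ is the identity). The DGA. The Legendrian closure $L_\beta$ of $\beta$ (in standard contact $\mathbf{R}^3$) has a front diagram $f_\beta$ obtained by closing up $\beta$ by $q$ nested strands above it, with $q$ left cusps and $q$ right cusps and no crossings other than those of $\beta$; $\gamma_\beta$ is the Lagrangian diagram obtained from $f_\beta$ by resolution, and its crossings are $b_1,\ldots,b_w$ together with $a_1,\ldots,a_q$ (one for each right cusp). Its Chekanov–Eliashberg DGA $\mathscr{A}$ is the free non-commutative unital algebra over $\mathbf{Z}_2$ on the generators $b_1,\ldots,b_w,a_1,\ldots,a_q$, with grading (index) $|b_k|=0$, $|a_n|=1$, and differential $\partial$ determined by the Leibniz rule, linearity, and $$\partial(b_k)=0,\qquad \partial(a_n)=1+C_{n,n},\qquad C_{n,n}=\sum_{(i_1,\ldots,i_c)\in D_n}B_{n,i_1}B_{i_1,i_2}\cdots B_{i_{c-1},i_c}B_{i_c,n}.$$ Here a finite sequence of positive integers is called admissible if for all $s\ge1$, between any two appearances of $s$ there is a number greater than $s$ appearing between them, and $D_n$ is the set of all admissible sequences composed of the numbers $1,\ldots,n-1$ (including the empty sequence, which contributes the term $B_{n,n}$). Augmentations. An augmentation of $\gamma_\beta$ is a subset $X$ of its crossings such that each element of $X$ has index $0$ and such that, for each generator $a$ of index $1$, $\varepsilon_X(\partial(a))=0$,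 where $\varepsilon_X\colon\mathscr{A}\to\mathbf{Z}_2$ is the algebra homomorphism sending elements of $X$ to $1$ and the other generators to $0$ (equivalently, the number of admissible discs with positive corner $a$ and all negative corners in $X$ is even). *)

(* Defs.v *)
From HB Require Import structures.
From mathcomp Require Import all_boot all_algebra finmap.
From mathcomp.multinomials Require Import monalg.

Set Implicit Arguments.
Unset Strict Implicit.
Unset Printing Implicit Defensive.

Import GRing.Theory.

Local Open Scope ring_scope.

(* The free noncommutative unital algebra over Z/2 on the finite set I: the
   monoid algebra of the free monoid on I. *)
Notation free_alg I := {malg 'F_2[{fmonom I}]}.

Definition gen (I : finType) (x : I) : free_alg I := << fmu x >>.

Definition word (I : finType) (s : seq I) : free_alg I := \prod_(x <- s) gen x.

Definition eval_word (I : finType) (X : {set I}) (m : {fmonom I}) : 'F_2 :=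
  \prod_(x <- m) (x \in X)%:R.

Lemma eval_word_mmorphism (I : finType) (X : {set I}) :
  mmorphism (eval_word X).
Proof.
by split=> [m1 m2|]; rewrite /eval_word ?fmM ?big_cat //= fm1 big_nil.
Qed.

HB.instance Definition _ (I : finType) (X : {set I}) :=
  isMultiplicative.Build _ _ (eval_word X) (eval_word_mmorphism X).

Definition eval (I : finType) (X : {set I}) : {rmorphism free_alg I -> 'F_2} :=
  mmap idfun (eval_word X).

Lemma eval_gen (I : finType) (X : {set I}) (x : I) :
  eval X (gen x) = (x \in X)%:R.
Proof. by rewrite /eval /= mmapU mul1r /eval_word fmU big_seq1. Qed.

(* The extension to the free algebra, by the Leibniz rule and by linearity, of
   a differential given on the generators; signs are irrelevant over Z/2. *)
Fixpoint diff_word (I : finType) (d : I -> free_alg I) (s : seq I) :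
    free_alg I :=
  if s is x :: s' then d x * word s' + gen x * diff_word d s' else 0.

Definition differential (I : finType) (d : I -> free_alg I) :
    {additive free_alg I -> free_alg I} :=
  mmap (@mkmalgU {fmonom I} 'F_2 mone) (fun m : {fmonom I} => diff_word d m).

Lemma differential_gen (I : finType) (d : I -> free_alg I) (x : I) :
  differential d (gen x) = d x.
Proof.
by rewrite /= mmapU fmU /= /word big_nil mulr1 mulr0 addr0 mul1r.
Qed.

Lemma malg_word (I : finType) (m : {fmonom I}) :
  << m >> = word m :> free_alg I.
Proof.
rewrite /word -[m in LHS]fmK; elim: {m}(m : seq I) => [|x s IH].
  by rewrite big_nil -fmoneE.
rewrite big_cons -IH /gen malgM_def fgmulUU mulr1; congr << _ *g _ >>.
by apply/eqP; rewrite fmP fmM fmU.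
Qed.

Lemma diff_word_cat (I : finType) (d : I -> free_alg I) (s1 s2 : seq I) :
  diff_word d (s1 ++ s2) = diff_word d s1 * word s2 + word s1 * diff_word d s2.
Proof.
elim: s1 => [|x s1 IH] /=; first by rewrite mul0r add0r /word big_nil mul1r.
rewrite IH mulrDl mulrDr !mulrA -addrA /word big_cat big_cons /=.
by rewrite !mulrA.
Qed.

Lemma free_algE (I : finType) (g : free_alg I) :
  g = \sum_(m <- msupp g) word m.
Proof.
rewrite [LHS]monalgE big_seq [RHS]big_seq; apply: eq_bigr => m.
rewrite -mcoeff_neq0 -malg_word; case: (g@_m) => [[|[|//]] i] //= _.
by congr << _ *g _ >>; apply: val_inj.
Qed.

Lemma differential_word (I : finType) (d : I -> free_alg I) (s : seq I) :
  differential d (word s) = diff_word d s.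
Proof. by rewrite -[s]/(FMonom s : seq I) -malg_word /= mmapU mul1r. Qed.

Lemma differentialM (I : finType) (d : I -> free_alg I) (f g : free_alg I) :
  differential d (f * g) = differential d f * g + f * differential d g.
Proof.
have Dw := @differential_word I d.
move: (differential d) Dw => D Dw.
rewrite (free_algE f) (free_algE g) mulr_suml !raddf_sum !mulr_suml.
rewrite -big_split; apply: eq_bigr => m _ /=.
rewrite !mulr_sumr raddf_sum -big_split; apply: eq_bigr => m' _ /=.
by rewrite !Dw -diff_word_cat -Dw /word big_cat.
Qed.

(* d is the differential on the generators and idx their grading. *)
Definition is_augmentation (I : finType) (idx : I -> int)
    (d : I -> free_alg I) (X : {set I}) : Prop :=
  (forall x : I, x \in X -> idx x = 0) /\
  (forall a : I, idx a = 1 -> eval X (differential d (gen a)) = 0).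

(* Levels are numbered from 0 to q.-1 from top to bottom, and c : 'I_q.-1
   stands for the standard generator of the braid group that exchanges the
   levels c and c.+1, so a word of length w is a w.-tuple 'I_q.-1. *)

(* A path travelling from left to right can go from level x to level y at a
   crossing of the levels c and c.+1: on the upper incoming strand it either
   turns and stays at level c or follows the strand down to level c.+1; on the
   lower one it can only follow the strand up to level c, a turn there being
   around the quadrant facing down. *)
Definition path_step (c x y : nat) : bool :=
  if x == c then (y == c) || (y == c.+1)
  else if x == c.+1 then y == c
  else y == x.

(* p k is the level of the path between the crossings k.-1 and k. *)
Definition is_path (q w : nat) (beta : w.-tuple 'I_q.-1) (i j : 'I_q)
    (p : {ffun 'I_w.+1 -> 'I_q}) : bool :=
  [&& p ord0 == i, p ord_max == j &
    [forall k : 'I_w,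
      path_step (tnth beta k) (p (widen_ord (leqnSn w) k)) (p (lift ord0 k))]].

Definition turns_at (q w : nat) (beta : w.-tuple 'I_q.-1)
    (p : {ffun 'I_w.+1 -> 'I_q}) (k : 'I_w) : bool :=
  (p (widen_ord (leqnSn w) k) == tnth beta k :> nat) &&
  (p (lift ord0 k) == tnth beta k :> nat).

(* The path matrix, for arbitrary labels b of the crossings. *)
Definition path_matrix (S : nzRingType) (q w : nat) (beta : w.-tuple 'I_q.-1)
    (b : 'I_w -> S) : 'M[S]_q :=
  \matrix_(i, j) \sum_(p | is_path beta i j p)
    \prod_(k < w | turns_at beta p k) b k.

(* The matrix B_sigma(b) of a single crossing, and the factorization of the path
   matrix that it yields. *)
Definition crossing_matrix (S : nzRingType) (q c : nat) (b : S) : 'M[S]_q :=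
  \matrix_(i, j)
    if i == c :> nat then if j == c :> nat then b else (j == c.+1 :> nat)%:R
    else if i == c.+1 :> nat then (j == c :> nat)%:R
    else (i == j)%:R.

Lemma prod_mulmxE (S : nzRingType) (q w : nat) (M : 'I_w -> 'M[S]_q)
    (i j : 'I_q) :
  (\big[mulmx/1%:M]_(k < w) M k) i j =
  \sum_(p : {ffun 'I_w.+1 -> 'I_q} | (p ord0 == i) && (p ord_max == j))
    \prod_(k < w) M k (p (widen_ord (leqnSn w) k)) (p (lift ord0 k)).
Proof.
elim: w M i => [|w IH] M i.
  rewrite big_ord0 mxE; case: eqVneq => [<-|ne_ij].
    rewrite (big_pred1 [ffun=> i]) => [|p]; first by rewrite big_ord0.
    have /= -> : (ord_max : 'I_1) = ord0 by apply: val_inj.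
    rewrite andbb; apply/eqP/eqP => [p0|->]; last by rewrite ffunE.
    by apply/ffunP => x; rewrite (ord1 x) ffunE.
  rewrite big_pred0 // => p; apply/negbTE/andP => -[/eqP p0 /eqP p1].
  by case/eqP: ne_ij; rewrite -p0 -p1; congr (p _); apply: val_inj.
rewrite big_ord_recl mxE.
pose tl (p : {ffun 'I_w.+2 -> 'I_q}) := [ffun k => p (lift ord0 k)].
pose cons_path (p : {ffun 'I_w.+1 -> 'I_q}) : {ffun 'I_w.+2 -> 'I_q} :=
  [ffun k => if unlift ord0 k is Some k' then p k' else i].
rewrite (reindex_onto cons_path tl) => [|p /andP[/eqP p0 _]]; last first.
  apply/ffunP => k; rewrite ffunE; case: unliftP => [k'|] ->; last by [].
  by rewrite ffunE.
have consL p k : cons_path p (lift ord0 k) = p k by rewrite ffunE liftK.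
have cons0 p : cons_path p ord0 = i by rewrite ffunE unlift_none.
have consM p : cons_path p ord_max = p ord_max.
  by rewrite -consL; congr (cons_path p _); apply: val_inj.
under [RHS]eq_bigl => p.
  rewrite cons0 consM eqxx /= (_ : tl _ = p) ?eqxx ?andbT; last first.
    by apply/ffunP => k; rewrite ffunE consL.
  over.
rewrite (partition_big (fun p : {ffun _ -> _} => p ord0) xpredT) //=.
apply: eq_bigr => l _; rewrite IH mulr_sumr.
apply: eq_big => [p|p /andP[/eqP p0 _]]; first by rewrite andbC.
rewrite big_ord_recl consL; congr (M _ _ _ * _).
- by rewrite -[LHS](cons0 p); congr (cons_path p _); apply: val_inj.
- by rewrite p0.
apply: eq_bigr => k _; rewrite consL -consL; congr (M _ (cons_path p _) _).
exact: val_inj.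
Qed.

Lemma path_matrixE (S : nzRingType) (q w : nat) (beta : w.-tuple 'I_q.-1)
    (b : 'I_w -> S) :
  path_matrix beta b =
  \big[mulmx/1%:M]_(k < w) crossing_matrix q (tnth beta k) (b k).
Proof.
apply/matrixP => i j; rewrite prod_mulmxE mxE.
rewrite [RHS](bigID (fun p : {ffun 'I_w.+1 -> 'I_q} => [forall k : 'I_w,
  path_step (tnth beta k) (p (widen_ord (leqnSn w) k)) (p (lift ord0 k))])) /=.
rewrite [X in _ + X]big1 ?addr0 => [|p /andP[_ /forallPn[k /negPf nk]]].
  apply: eq_big => [p|p /and3P[_ _ /forallP step_p]]; first by rewrite -andbA.
  rewrite big_mkcond; apply: eq_bigr => k _; move: (step_p k).
  rewrite mxE /turns_at /path_step; case: eqP => _ /=.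
    by case: eqP => //= _ ->.
  by case: eqP => _ => [->|]; rewrite // eq_sym val_eqE => ->.
have: k \in index_enum 'I_w by rewrite mem_index_enum.
case/splitPr => s1 s2; rewrite big_cat big_cons /= [X in _ * (X * _)]mxE.
move: nk; rewrite /path_step; case: eqP => _; last first.
  case: eqP => _ nk; rewrite ?nk ?mul0r ?mulr0 //.
  by rewrite eq_sym -val_eqE /= nk mul0r mulr0.
by case: eqP => //= _ ->; rewrite mul0r mulr0.
Qed.

Definition admissible (s : seq nat) : bool :=
  [forall i : 'I_(size s), forall j : 'I_(size s),
    ((i < j)%N && (nth 0%N s i == nth 0%N s j)) ==>
    [exists k : 'I_(size s), (i < k < j)%N && (nth 0%N s i < nth 0%N s k)%N]].

Lemma admissibleP (s : seq nat) :
  reflect (forall i j : nat,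
             (i < j < size s)%N -> nth 0%N s i = nth 0%N s j ->
             exists2 k : nat, (i < k < j)%N & (nth 0%N s i < nth 0%N s k)%N)
          (admissible s).
Proof.
apply: (iffP forallP) => [adm i j /andP[lt_ij lt_j] eq_ij|adm i].
  have /forallP/(_ (Ordinal lt_j)) := adm (Ordinal (ltn_trans lt_ij lt_j)).
  rewrite /= lt_ij eq_ij eqxx /= => /existsP[k /andP[kP ltk]].
  by exists k.
apply/forallP => j; apply/implyP => /andP[lt_ij /eqP eq_ij].
have [|k /andP[lt_ik lt_kj] ltk] := adm i j _ eq_ij; first by rewrite lt_ij /=.
apply/existsP; exists (Ordinal (ltn_trans lt_kj (ltn_ord j))) => /=.
by rewrite lt_ik lt_kj.
Qed.

Lemma admissible_infix (s1 s2 s3 : seq nat) :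
  admissible (s1 ++ s2 ++ s3) -> admissible s2.
Proof.
move=> /admissibleP adm; apply/admissibleP => i j /andP[lt_ij lt_j] eq_ij.
have nthE k : (k < size s2)%N ->
    nth 0%N (s1 ++ s2 ++ s3) (size s1 + k) = nth 0%N s2 k.
  by move=> lt_k; rewrite nth_cat ltnNge leq_addr /= addKn nth_cat lt_k.
have lt_i := ltn_trans lt_ij lt_j.
have [||k /andP[lt_ik lt_kj]] := adm (size s1 + i)%N (size s1 + j)%N.
- by rewrite ltn_add2l lt_ij !size_cat ltn_add2l ltn_addr.
- by rewrite !nthE.
have le_k : (size s1 <= k)%N by apply: leq_trans (leq_addr i _) (ltnW lt_ik).
rewrite -(subnKC le_k) !ltn_add2l in lt_ik lt_kj *.
rewrite !nthE //; last exact: ltn_trans lt_j.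
by move=> ltk; exists (k - size s1)%N; rewrite ?lt_ik.
Qed.

Lemma size_admissible (n : nat) (s : seq nat) :
  admissible s -> all (fun x => x < n)%N s -> (size s < 2 ^ n)%N.
Proof.
elim: n s => [|n IH] s adm; first by case: s adm.
have drop_n t : n \notin t -> all (fun x => x < n.+1)%N t ->
    all (fun x => x < n)%N t.
  move=> nt /allP lt_t; apply/allP => x xt; rewrite ltn_neqAle -ltnS lt_t //.
  by rewrite andbT; apply: contraNneq nt => <-.
have pow2 : (2 ^ n <= 2 ^ n.+1)%N by rewrite leq_exp2l.
have [ns|/negPf ns] := boolP (n \in s); last first.
  move=> /drop_n; rewrite ns => /(_ isT) /(IH _ adm) lt_s.
  exact: leq_trans pow2.
case/splitPr: ns adm => s1 s2 adm; rewrite all_cat /= => /and3P[lt1 _ lt2].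
have noN i j : (i < j < size (s1 ++ n :: s2))%N ->
    nth 0%N (s1 ++ n :: s2) i = n -> nth 0%N (s1 ++ n :: s2) j = n -> False.
  move=> ij ni nj; case/admissibleP/(_ i j ij): (adm); first by rewrite ni nj.
  move=> k /andP[_ lt_kj]; rewrite ni.
  have lt_k : (k < size (s1 ++ n :: s2))%N.
    by case/andP: ij => _; apply: ltn_trans.
  have: all (fun x => x < n.+1)%N (s1 ++ n :: s2).
    by rewrite all_cat /= lt1 ltnSn.
  by move/(all_nthP 0%N)/(_ k lt_k); rewrite ltnS leqNgt => /negP.
have n1 : n \notin s1.
  apply/negP => n1; apply: (noN (index n s1) (size s1)).
  - by rewrite index_mem n1 size_cat /= -addSnnS ltn_addr.
  - by rewrite nth_cat index_mem n1 nth_index.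
  - by rewrite nth_cat ltnn subnn.
have n2 : n \notin s2.
  apply/negP => n2; apply: (noN (size s1) (size s1 + (index n s2).+1)%N).
  - by rewrite -addSnnS leq_addr size_cat /= addSnnS ltn_add2l ltnS index_mem.
  - by rewrite nth_cat ltnn subnn.
  - by rewrite nth_cat ltnNge leq_addr /= addKn /= nth_index.
have adm1 := @admissible_infix [::] s1 (n :: s2) adm.
have adm2 : admissible s2.
  by apply: (@admissible_infix (rcons s1 n) s2 [::]); rewrite cats0 cat_rcons.
have := IH _ adm1 (drop_n _ n1 lt1); have := IH _ adm2 (drop_n _ n2 lt2).
rewrite size_cat /= expnS mul2n -addnn => lt_2 lt_1.
by rewrite -addSn leq_add.
Qed.

(* M i s_1 * M s_1 s_2 * ... * M s_c j *)
Fixpoint walk_prod (S : nzRingType) (q : nat) (M : 'M[S]_q) (i : 'I_q)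
    (s : seq 'I_q) (j : 'I_q) : S :=
  if s is k :: s' then M i k * walk_prod M k s' j else M i j.

(* The sum C_{n,n}: it runs over all the admissible sequences of levels smaller
   than n, since these have length less than 2 ^ n by size_admissible. *)
Definition admissible_sum (S : nzRingType) (q : nat) (M : 'M[S]_q)
    (n : 'I_q) : S :=
  \sum_(c < 2 ^ n) \sum_(s : c.-tuple 'I_n | admissible (map val s))
    walk_prod M n (map (widen_ord (ltnW (ltn_ord n))) s) n.

(* The crossings of the resolved closure of a word of length w on q strands:
   inl k is b_(k+1) and inr n is a_(n+1). *)
Definition crossing (q w : nat) : finType := ('I_w + 'I_q)%type.

Definition crossing_index (q w : nat) (x : crossing q w) : int :=
  if x is inr _ then 1 else 0.

Definition braid_matrix (q w : nat) (beta : w.-tuple 'I_q.-1) :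
    'M[free_alg (crossing q w)]_q :=
  path_matrix beta (fun k => gen (inl k : crossing q w)).

Definition crossing_diff (q w : nat) (beta : w.-tuple 'I_q.-1)
    (x : crossing q w) : free_alg (crossing q w) :=
  if x is inr n then 1 + admissible_sum (braid_matrix beta) n else 0.

Definition upper_left (S : Type) (q n : nat) (le_nq : (n <= q)%N)
    (M : 'M[S]_q) : 'M[S]_n :=
  mxsub (widen_ord le_nq) (widen_ord le_nq) M.

(* Main.v *)
(* Write W_n(i, j) for the sum of the products of M along the walks from i to j
   whose intermediate levels form an admissible sequence of numbers below n, so
   that C_{n,n} = W_n(n, n). An admissible sequence contains its maximum at most
   once; cutting it there gives
     W_{n+1}(i, j) = W_n(i, j) + W_n(i, n) W_n(n, j),
   which over Z/2 is a step of Gaussian elimination whenever the pivot W_n(n, n)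
   is 1. If the pivots before the n-th one are all 1, then the corner of size
   n+1 is a product LU of triangular matrices whose diagonals both consist of
   the pivots, so its determinant is W_n(n, n)^2 = W_n(n, n). *)

Require Import Defs.
From mathcomp Require Import all_boot all_algebra.
From mathcomp.multinomials Require Import monalg.

Set Implicit Arguments.
Unset Strict Implicit.
Unset Printing Implicit Defensive.

Import GRing.Theory.

Local Open Scope ring_scope.

(** * Arithmetic of the field with two elements *)

Lemma addrr_F2 (x : 'F_2) : x + x = 0.
Proof. by rewrite -mulr2n -mulr_natr pchar_Zp // mulr0. Qed.

Lemma mulrr_F2 (x : 'F_2) : x * x = x.
Proof. by case: x => [[|[|//]] lt_x]; apply: val_inj. Qed.

(** * Cutting admissible sequences at their maximum *)

Lemma admissible_between (x : nat) (s : seq nat) :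
  admissible (x :: rcons s x) -> has (ltn x) s.
Proof.
move=> /admissibleP/(_ 0%N (size s).+1).
rewrite /= size_rcons nth_rcons ltnn eqxx ltnSn => /(_ isT erefl).
case=> -[|k] //=; rewrite ltnS nth_rcons => lt_k; rewrite lt_k => lt_x.
by apply/(has_nthP 0%N); exists k.
Qed.

(** Equal letters on opposite sides of the cut are separated by the larger [n], and no letter of
    [s1] or [s2] equals [n]; only pairs within one side impose a condition. *)
Lemma admissible_cat_max (n : nat) (s1 s2 : seq nat) :
  all (ltn^~ n) s1 -> all (ltn^~ n) s2 ->
  admissible (s1 ++ n :: s2) = admissible s1 && admissible s2.
Proof.
move=> lt1 lt2; apply/idP/andP => [adm|[/admissibleP adm1 /admissibleP adm2]].
  split; first exact: (@admissible_infix [::] _ (n :: s2)).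
  by apply: (@admissible_infix (rcons s1 n) _ [::]); rewrite cats0 cat_rcons.
have nthl k : (k < size s1)%N -> nth 0%N (s1 ++ n :: s2) k = nth 0%N s1 k.
  by rewrite nth_cat => ->.
have nthm : nth 0%N (s1 ++ n :: s2) (size s1) = n.
  by rewrite nth_cat ltnn subnn.
have nthr k : nth 0%N (s1 ++ n :: s2) ((size s1).+1 + k) = nth 0%N s2 k.
  by rewrite nth_cat ltnNge addSnnS leq_addr /= addKn.
have ltl k : (k < size s1)%N -> (nth 0%N s1 k < n)%N.
  by move/(all_nthP 0%N): lt1; apply.
have ltr k : (k < size s2)%N -> (nth 0%N s2 k < n)%N.
  by move/(all_nthP 0%N): lt2; apply.
apply/admissibleP => i j; rewrite size_cat /= -addSnnS => /andP[lt_ij lt_j].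
have [lt_i1|gt_i1|eq_i1] := ltngtP i (size s1).
- have [lt_j1|gt_j1|->] := ltngtP j (size s1).
  + rewrite !nthl // => eq_ij; have [|k /andP[ik kj] ltk] := adm1 i j _ eq_ij.
      by rewrite lt_ij.
    by exists k; rewrite ?ik // nthl //; apply: ltn_trans lt_j1.
  + by exists (size s1); [rewrite lt_i1 | rewrite nthm nthl ?ltl].
  + by rewrite nthm nthl // => eq_n; have := ltl _ lt_i1; rewrite eq_n ltnn.
- have gt_j1 := ltn_trans gt_i1 lt_ij.
  rewrite -(subnKC gt_i1) -(subnKC gt_j1) !ltn_add2l !nthr in lt_ij lt_j *.
  move=> eq_ij; have [|k /andP[ik kj] ltk] := adm2 _ _ _ eq_ij.
    by rewrite lt_ij.
  by exists ((size s1).+1 + k)%N; rewrite ?ltn_add2l ?ik // nthr.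
(* Here [i] is the position of [n], so an equal letter at [j] would be an [n] inside [s2]. *)
rewrite eq_i1 in lt_ij *; rewrite -(subnKC lt_ij) ltn_add2l in lt_j *.
by rewrite nthm nthr => eq_n; have := ltr _ lt_j; rewrite -eq_n ltnn.
Qed.

(** Sorted by whether the top letter [m] occurs, rather than by length, so that sums over the list
    obey a recursion in [n]. *)
Fixpoint admissible_seqs (n : nat) : seq (seq nat) :=
  if n is m.+1 then
    admissible_seqs m ++
    [seq s ++ m :: t | s <- admissible_seqs m, t <- admissible_seqs m]
  else [:: [::]].

Lemma mem_admissible_seqs (n : nat) (s : seq nat) :
  (s \in admissible_seqs n) = admissible s && all (ltn^~ n) s.
Proof.
elim: n s => [|n IH] s.
  rewrite inE; case: s => [|x s]; last by rewrite andbF.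
  by rewrite eqxx andbT; apply/esym/admissibleP => i j; rewrite ltn0 andbF.
have lt_all t : all (ltn^~ n) t = all (ltn^~ n.+1) t && (n \notin t).
  rewrite -has_pred1 -all_predC -all_predI; apply: eq_all => x /=.
  by rewrite ltnS ltn_neqAle andbC.
rewrite mem_cat IH; apply/orP/andP => [[/andP[adm lt_s]|]|[adm lt_s]].
- by rewrite lt_all in lt_s; case/andP: lt_s.
- case/allpairsP=> -[s1 s2] /= [+ + ->]; rewrite !IH.
  move=> /andP[adm1 lt1] /andP[adm2 lt2]; rewrite admissible_cat_max // adm1.
  by move: lt1 lt2; rewrite !lt_all all_cat /= ltnSn => /andP[-> _] /andP[-> _].
have [ns|ns] := boolP (n \in s); last by left; rewrite adm lt_all lt_s.
right; case/splitPr: ns adm lt_s => s1 s2 adm.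
rewrite all_cat /= => /and3P[lt1 _ lt2].
(* A second [n] on either side of the cut would require a letter greater than [n] between the
   two. *)
have no_larger t : all (ltn^~ n.+1) t -> has (ltn n) t -> False.
  move=> /allP lt_t /hasP[x /lt_t /=].
  by rewrite ltnS leqNgt => /negP.
have n1 : n \notin s1.
  apply/negP => n1; case/splitPr: n1 adm lt1 => t1 t2.
  rewrite all_cat /= => adm /and3P[_ _ /no_larger no_t2].
  apply/no_t2/admissible_between/(@admissible_infix t1 _ s2).
  by rewrite /= cat_rcons -cat_cons catA.
have n2 : n \notin s2.
  apply/negP => n2; case/splitPr: n2 adm lt2 => t1 t2.
  rewrite all_cat /= => adm /and3P[/no_larger no_t1 _ _].
  apply/no_t1/admissible_between/(@admissible_infix s1 _ t2).
  by rewrite /= cat_rcons.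
have lt1' : all (ltn^~ n) s1 by rewrite lt_all lt1.
have lt2' : all (ltn^~ n) s2 by rewrite lt_all lt2.
move: adm; rewrite admissible_cat_max // => /andP[adm1 adm2].
by apply/allpairsP; exists (s1, s2); rewrite !IH adm1 adm2.
Qed.

(** Since [n] occurs in neither part, its first index in [s ++ n :: t] is the size of [s], which
    recovers both parts. Over ['F_2] a repeated term would cancel, so multiplicities matter. *)
Lemma uniq_admissible_seqs (n : nat) : uniq (admissible_seqs n).
Proof.
elim: n => //= n IH.
have notin s : s \in admissible_seqs n -> n \notin s.
  rewrite mem_admissible_seqs => /andP[_ /allP lt_s].
  by apply/negP => /lt_s /=; rewrite ltnn.
rewrite cat_uniq IH /=; apply/andP; split.
  apply/hasPn => _ /allpairsP[[s t] /= [_ _ ->]].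
  by apply/negP => /notin; rewrite mem_cat mem_head orbT.
apply: allpairs_uniq => // -[? ?] [? ?].
move=> /allpairsP[[s1 t1] /= [/notin n1 _ [-> ->]]].
move=> /allpairsP[[s2 t2] /= [/notin n2 _ [-> ->]]] eq_st.
have eq_size : size s1 = size s2.
  have index_n s t : n \notin s -> index n (s ++ n :: t) = size s.
    by move=> ns; rewrite index_cat (negPf ns) /= eqxx addn0.
  by rewrite -(index_n _ t1 n1) eq_st index_n.
by move/eqP: eq_st; rewrite eqseq_cat // => /andP[/eqP-> /eqP[->]].
Qed.

Lemma sum_admissible_seqs (S : nzRingType) (n : nat) (F : seq nat -> S) :
  \sum_(c < 2 ^ n) \sum_(s : c.-tuple 'I_n | admissible (map val s))
    F (map val s) = \sum_(s <- admissible_seqs n) F s.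
Proof.
have sumF (c : 'I_(2 ^ n)) :
    \sum_(s : c.-tuple 'I_n | admissible (map val s)) F (map val s) =
    \sum_(s <- admissible_seqs n | size s == c) F s.
  rewrite -[RHS]big_filter -[LHS]big_filter.
  rewrite -(big_map (fun s : c.-tuple 'I_n => map val s) xpredT).
  apply/perm_big/uniq_perm; last 1 first.
  - move=> s; rewrite mem_filter mem_admissible_seqs.
    apply/mapP/and3P => [[t]|[/eqP size_s adm lt_s]].
      rewrite mem_filter => /andP[adm _] ->.
      rewrite size_map size_tuple eqxx adm; split=> //.
      by apply/allP => _ /mapP[x _ ->]; apply: ltn_ord.
    have [t def_s] : {t : seq 'I_n | s = map val t}.
      exists (pmap insub s); rewrite pmap_filter; last exact: insubK.
      by apply/esym/all_filterP/allP => x /(allP lt_s) lt_x; rewrite insubT.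
    have size_t : size t == c by rewrite -size_s def_s size_map.
    exists (Tuple size_t) => //.
    by rewrite mem_filter mem_index_enum -[map _ _]def_s adm.
  - rewrite map_inj_uniq ?filter_uniq ?index_enum_uniq //.
    by move=> s t /(inj_map val_inj) /val_inj.
  - exact/filter_uniq/uniq_admissible_seqs.
rewrite (eq_bigr _ (fun c _ => sumF c)) (exchange_big_dep xpredT) //=.
rewrite big_seq [RHS]big_seq; apply: eq_bigr => s.
rewrite mem_admissible_seqs => /andP[adm lt_s].
(* The length bound [2 ^ n] makes the size of [s] one of the values of [c], so [s] is counted
   exactly once. *)
by rewrite (big_pred1 (Ordinal (size_admissible adm lt_s))).
Qed.

(** * Walk sums and Gaussian elimination *)

Fixpoint walk_prod_nat (S : nzRingType) (f : nat -> nat -> S) (i : nat)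
    (s : seq nat) (j : nat) : S :=
  if s is k :: s' then f i k * walk_prod_nat f k s' j else f i j.

Lemma walk_prod_nat_cat (S : nzRingType) (f : nat -> nat -> S) (i k j : nat)
    (s t : seq nat) :
  walk_prod_nat f i (s ++ k :: t) j =
  walk_prod_nat f i s k * walk_prod_nat f k t j.
Proof. by elim: s i => [|l s IH] i //=; rewrite IH mulrA. Qed.

(* Gaussian elimination without division: over 'F_2 the entry (k, k) is the
   pivot of the k-th step, and the step is correct only when this is 1. *)
Fixpoint eliminate (S : nzRingType) (f : nat -> nat -> S) (n i j : nat) : S :=
  if n is k.+1 then
    eliminate f k i j + eliminate f k i k * eliminate f k k j
  else f i j.

(** A walk through level [n] visits it once; its product factors there, and the two halves vary
    independently, which is the recursion of [eliminate]. *)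
Lemma sum_walk_prod_nat (S : nzRingType) (f : nat -> nat -> S) (n i j : nat) :
  \sum_(s <- admissible_seqs n) walk_prod_nat f i s j = eliminate f n i j.
Proof.
elim: n i j => [|n IH] i j; first by rewrite big_seq1.
rewrite big_cat big_allpairs_dep /= -!IH mulr_suml; congr (_ + _).
apply: eq_bigr => s _; rewrite mulr_sumr.
by apply: eq_bigr => t _; apply: walk_prod_nat_cat.
Qed.

(** With pivot 1, the step adds to each entry of the pivot row or column a copy of itself, which
    kills it in characteristic 2; lines cleared earlier stay zero. *)
Lemma eliminate_eq0 (f : nat -> nat -> 'F_2) (n : nat) :
  (forall k, (k < n)%N -> eliminate f k k k = 1) ->
  forall i j, (i < n)%N || (j < n)%N -> eliminate f n i j = 0.
Proof.
elim: n => [|n IH] pivot i j //=.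
have {}IH := IH (fun k lt_k => pivot k (ltnW lt_k)).
rewrite (ltnS i) (leq_eqVlt i) (ltnS j) (leq_eqVlt j).
move=> /orP[/predU1P[->|lt_i]|/predU1P[->|lt_j]].
- by rewrite pivot // mul1r addrr_F2.
- by rewrite !(IH i) ?lt_i // mul0r addr0.
- by rewrite pivot // mulr1 addrr_F2.
by rewrite !(IH _ j) ?lt_j ?orbT // mulr0 addr0.
Qed.

(** Telescoping: the term added at each step is added once more, and the two copies cancel. *)
Lemma eliminateE (f : nat -> nat -> 'F_2) (n i j : nat) :
  f i j = eliminate f n i j +
          \sum_(k < n) eliminate f k i k * eliminate f k k j.
Proof.
elim: n => [|n IH]; first by rewrite big_ord0 addr0.
by rewrite big_ord_recr /= addrACA addrr_F2 addr0.
Qed.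

Lemma det_eliminate (f : nat -> nat -> 'F_2) (n : nat) :
  (forall k, (k < n)%N -> eliminate f k k k = 1) ->
  \det (\matrix_(i < n.+1, j < n.+1) f i j) = eliminate f n n n.
Proof.
move=> pivot.
have elim0 k i j : (k <= n)%N -> (i < k)%N || (j < k)%N ->
    eliminate f k i j = 0.
  move=> le_k; apply: eliminate_eq0 => l lt_l.
  by apply: pivot; apply: leq_trans le_k.
have det_diag : \prod_(k < n.+1) eliminate f k k k = eliminate f n n n.
  by rewrite big_ord_recr /= big1 ?mul1r // => k _; apply: pivot.
pose L := \matrix_(i < n.+1, k < n.+1) eliminate f k i k.
pose U := \matrix_(k < n.+1, j < n.+1) eliminate f k k j.
have detL : \det L = eliminate f n n n.
  rewrite det_trig; first by under eq_bigr => k _ do rewrite mxE.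
  by apply/is_trig_mxP => i k lt_ik; rewrite mxE elim0 ?lt_ik // -ltnS.
have detU : \det U = eliminate f n n n.
  rewrite -det_tr det_trig; first by under eq_bigr => k _ do rewrite !mxE.
  by apply/is_trig_mxP => j k lt_jk; rewrite !mxE elim0 ?lt_jk ?orbT // -ltnS.
rewrite (_ : \matrix_(i, j) _ = L *m U).
  by rewrite det_mulmx detL detU mulrr_F2.
apply/matrixP => i j; rewrite !mxE (eliminateE f n.+1 i j) /=.
under [in RHS]eq_bigr => k _ do rewrite !mxE.
(* The pivot at [n] may be 0, so [eliminate_eq0] stops at [n]. Of the entries with indices at most
   [n], it leaves only (n, n), where the remainder is x + x * x = 0. *)
suff -> : eliminate f n i j + eliminate f n i n * eliminate f n n j = 0.
  by rewrite add0r.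
have := ltn_ord i; rewrite ltnS leq_eqVlt => /predU1P[->|lt_i]; last first.
  by rewrite !(elim0 n i) ?lt_i // mul0r addr0.
have := ltn_ord j; rewrite ltnS leq_eqVlt => /predU1P[->|lt_j]; last first.
  by rewrite !(elim0 n n j) ?lt_j ?orbT // mulr0 addr0.
by rewrite mulrr_F2 addrr_F2.
Qed.

(** From determinants to pivots, the induction is strong: [det_eliminate] reads off the pivot at [n]
    only once all earlier ones are known to be 1. *)
Lemma eliminate_eq1_det (f : nat -> nat -> 'F_2) (q : nat) :
  (forall n, (n < q)%N -> eliminate f n n n = 1) <->
  (forall n, (n < q)%N -> \det (\matrix_(i < n.+1, j < n.+1) f i j) = 1).
Proof.
split=> [pivot n lt_n|det1 n].
  by rewrite det_eliminate ?pivot // => k lt_k; apply/pivot/(ltn_trans lt_k).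
elim/ltn_ind: n => n IH lt_n; rewrite -det_eliminate ?det1 // => k lt_k.
by apply: IH => //; apply: ltn_trans lt_n.
Qed.

(** * Transfer to the path matrix and its evaluation *)

(** The default 0 never enters the pivots and corners of the theorem, whose indices all lie below
    [q]. *)
Definition nat_entry (S : nzRingType) (q : nat) (M : 'M[S]_q) (i j : nat) : S :=
  if (insub i, insub j) is (Some i', Some j') then M i' j' else 0.

Lemma nat_entryE (S : nzRingType) (q : nat) (M : 'M[S]_q) (i j : 'I_q) :
  nat_entry M i j = M i j.
Proof. by rewrite /nat_entry !valK. Qed.

Lemma walk_prodE (S : nzRingType) (q : nat) (M : 'M[S]_q) (i j : 'I_q)
    (s : seq 'I_q) :
  walk_prod M i s j = walk_prod_nat (nat_entry M) i (map val s) j.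
Proof. by elim: s i => [|k s IH] i /=; rewrite nat_entryE ?IH. Qed.

Lemma admissible_sumE (S : nzRingType) (q : nat) (M : 'M[S]_q) (n : 'I_q) :
  admissible_sum M n = eliminate (nat_entry M) n n n.
Proof.
rewrite -sum_walk_prod_nat -sum_admissible_seqs; apply: eq_bigr => c _.
by apply: eq_bigr => s _; rewrite walk_prodE -map_comp.
Qed.

Lemma rmorph_walk_prod (S T : nzRingType) (h : {rmorphism S -> T})
    (q : nat) (M : 'M[S]_q) (i j : 'I_q) (s : seq 'I_q) :
  h (walk_prod M i s j) = walk_prod (map_mx h M) i s j.
Proof. by elim: s i => [|k s IH] i /=; rewrite ?rmorphM ?IH mxE. Qed.

(** Lets the evaluation be applied to the entries first, so that elimination takes place over
    ['F_2]. *)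
Lemma rmorph_admissible_sum (S T : nzRingType) (h : {rmorphism S -> T})
    (q : nat) (M : 'M[S]_q) (n : 'I_q) :
  h (admissible_sum M n) = admissible_sum (map_mx h M) n.
Proof.
rewrite rmorph_sum; apply: eq_bigr => c _; rewrite rmorph_sum.
by apply: eq_bigr => s _; apply: rmorph_walk_prod.
Qed.

Lemma upper_leftE (S : nzRingType) (q n : nat) (le_nq : (n <= q)%N)
    (M : 'M[S]_q) :
  upper_left le_nq M = \matrix_(i < n, j < n) nat_entry M i j.
Proof. by apply/matrixP => i j; rewrite !mxE -nat_entryE. Qed.

Theorem theorem5p3 (q w : nat) (beta : w.-tuple 'I_q.-1)
    (Y : {set crossing q w}) (Y_b : Y \subset [set inl k | k in 'I_w]) :
  is_augmentation (@crossing_index q w) (crossing_diff beta) Y <->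
  (forall (n : nat) (le_nq : (n <= q)%N), (0 < n)%N ->
     \det (upper_left le_nq (map_mx (eval Y) (braid_matrix beta))) = 1).
Proof.
set M := map_mx _ _.
have aug_n (n : 'I_q) :
    eval Y (differential (crossing_diff beta) (gen (inr n))) =
    1 + eliminate (nat_entry M) n n n.
  by rewrite differential_gen rmorphD rmorph1 rmorph_admissible_sum
             admissible_sumE.
have eq1 (x : 'F_2) : 1 + x = 0 <-> x = 1.
  split=> [x1|->]; last exact: addrr_F2.
  by rewrite -[x]add0r -(addrr_F2 1) -addrA x1 addr0.
(* Both conditions are compared with all pivots of the evaluated path matrix being 1. *)
transitivity (forall n, (n < q)%N -> eliminate (nat_entry M) n n n = 1).
  split=> [[_ aug] n lt_n|pivot].
    by apply/eq1; rewrite -(aug_n (Ordinal lt_n)); apply: aug.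
  (* Elements of [Y] are of the form [inl k], hence of index 0; among the generators only the
     [inr n] have index 1. *)
  split=> [x /(subsetP Y_b)/imsetP[k _ ->] //|[k|n] // _].
  by rewrite aug_n; apply/eq1/pivot.
(* The pivot at [n] belongs to the corner of size [n.+1]; size 0 is excluded by positivity. *)
rewrite eliminate_eq1_det; split=> [det1 [//|n] lt_n _|det1 n lt_n].
  by rewrite upper_leftE det1.
by rewrite -(upper_leftE lt_n) det1.
Qed.
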